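(* Let $A$ be a finite-dimensional local commutative associative unital $\mathbb{C}$-algebra which is Gorenstein and of full null-index. Then the Lie algebra $\operatorname{Der}(A)$ of $\mathbb{C}$-linear derivations of $A$ is solvable.
   Context: The base field is $\mathbb{C}$. A local algebra is a unital, commutative, associative, finite-dimensional $\mathbb{C}$-algebra $A$ with exactly one maximal ideal $\mathfrak{m}$; then $A=\mathbb{C}\cdot 1\oplus\mathfrak{m}$ and $\mathfrak{m}$ is nilpotent. $\operatorname{Der}(A)=\{\xi\in\mathfrak{gl}(A): \xi(ab)=\xi(a)b+a\xi(b)\ \ \forall a,b\in A\}$, a Lie algebra under the commutator. Every $\xi\in\operatorname{Der}(A)$ satisfies $\xi(\mathfrak{m})\subset\mathfrak{m}$ (hence also $\xi(\mathfrak{m}^2)\subset\mathfrak{m}^2$). The socle is $\operatorname{Soc}(A)=\{a\in\mathfrak{m}: am=0\ \ \forall m\in\mathfrak{m}\}$. The algebra $A$ is called Gorenstein if $\dim_{\mathbb{C}}\operatorname{Soc}(A)=1$. Let $A$ be Gorenstein, and let $r$ be the integer with $\mathfrak{m}^r\neq 0$, $\mathfrak{m}^{r+1}=0$ (so $\mathfrak{m}^r=\operatorname{Soc}(A)$). Fix a nonzero $s\in\operatorname{Soc}(A)$, so $\operatorname{Soc}(A)=\langle s\rangle$. Put $V=\mathfrak{m}/\mathfrak{m}^2$, let $\pi:\mathfrak{m}\to V$ be the canonical projection, and let $\rho:\operatorname{Der}(A)\to\mathfrak{gl}(V)$ be the representation $\rho(\xi)(m+\mathfrak{m}^2)=\xi(m)+\mathfrak{m}^2$.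 The index polynomial $P_A\in\mathbb{C}[V]$ is the homogeneous polynomial function of degree $r$ on $V$ defined by $m^r=P_A(\pi(m))\,s$ for all $m\in\mathfrak{m}$ (it is well defined since $m^r$ depends only on $\pi(m)$; another choice of $s$ rescales $P_A$ by a nonzero constant). A Gorenstein algebra $A$ is of full null-index if for every nonzero $\xi\in\operatorname{Der}(A)$ and every eigenvalue $\lambda$ of the operator $\rho(\xi)$ on $V$ there is an eigenvector $v\in V_\lambda=\{v\in V:\rho(\xi)v=\lambda v\}$ with $P_A(v)\neq 0$. *)

(* Defs.v *)
From HB Require Import structures.
From mathcomp Require Import all_boot all_order all_algebra.
From mathcomp Require Import generic_quotient ring_quotient falgebra.
From mathcomp Require Import reals complex ring.

Set Implicit Arguments.
Unset Strict Implicit.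
Unset Printing Implicit Defensive.

Import Order.TTheory GRing.Theory Num.Theory.
Import passmx.
Local Open Scope ring_scope.
Local Open Scope quotient_scope.

#[short(type="comFalgType")]
HB.structure Definition ComFalgebra (R : nzRingType) :=
  { A of Falgebra R A & GRing.PzRing_hasCommutativeMul A }.

Section QuotientSpace.
Variables (F : fieldType) (vT : vectType F) (W : {vspace vT}).

(* [ring_quotient] only provides the additive group of cosets vT / W. *)
Definition vquot : Type := Quotient.quot (pred_of_vspace W).

HB.instance Definition _ := GRing.Zmodule.on vquot.
HB.instance Definition _ := EqQuotient.on vquot.

Lemma vquot_piE x y : (\pi_vquot x == \pi_vquot y) = (x - y \in W).
Proof. by rewrite [RHS]Quotient.idealrBE. Qed.

Lemma vquot_repr_sub x : x - repr (\pi_vquot x) \in W.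
Proof. by rewrite -vquot_piE reprK. Qed.

Lemma vquot_pi_is_zmod_morphism : zmod_morphism (\pi_vquot : vT -> vquot).
Proof. exact: pi_is_zmod_morphism. Qed.

Definition vquot_scale (a : F) (v : vquot) : vquot := \pi_vquot (a *: repr v).

Lemma vquot_pi_scale a x : \pi_vquot (a *: x) = vquot_scale a (\pi_vquot x).
Proof. by apply/eqP; rewrite vquot_piE -scalerBr memvZ ?vquot_repr_sub. Qed.

Fact vquot_scaleA a b v :
  vquot_scale a (vquot_scale b v) = vquot_scale (a * b) v.
Proof. by rewrite -[v]reprK -!vquot_pi_scale scalerA reprK. Qed.

Fact vquot_scale1 : left_id 1 vquot_scale.
Proof. by move=> v; rewrite -[v]reprK -vquot_pi_scale scale1r. Qed.

Let piB := vquot_pi_is_zmod_morphism.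
Let piD x y : \pi_vquot (x + y) = \pi_vquot x + \pi_vquot y :> vquot.
Proof.
have pi0 : \pi_vquot 0 = 0 :> vquot by rewrite -(subrr (0 : vT)) piB subrr.
by rewrite -{1}[y]opprK piB -[- y]sub0r piB pi0 sub0r opprK.
Qed.

Fact vquot_scaleDr : right_distributive vquot_scale +%R.
Proof.
move=> a u v; rewrite -[u]reprK -[v]reprK -piD -!vquot_pi_scale.
by rewrite scalerDr piD.
Qed.

Fact vquot_scaleDl v : {morph vquot_scale^~ v : a b / a + b}.
Proof. by move=> a b; rewrite -[v]reprK -!vquot_pi_scale scalerDl piD. Qed.

HB.instance Definition _ := GRing.Zmodule_isLmodule.Build F vquot
  vquot_scaleA vquot_scale1 vquot_scaleDr vquot_scaleDl.

Lemma vquot_pi_is_linear : linear (\pi_vquot : vT -> vquot).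
Proof. by move=> a x y; rewrite piD vquot_pi_scale. Qed.

Fact vquot_vect_iso : Vector.axiom (\dim W^C) vquot.
Proof.
pose q : 'End(vT) := (\1 - projv W)%VF.
have qE x : q x = x - projv W x by rewrite !lfun_simp.
have qW x : x \in W -> q x = 0 by move=> xW; rewrite qE projv_id ?subrr.
have qWC x : x \in (W^C)%VS -> q x = x.
  move=> xC; rewrite qE; suff /eqP-> : projv W x == 0 by rewrite subr0.
  rewrite -memv0 -(capv_compl W) memv_cap memv_proj /=.
  by rewrite -[projv W x](subKr x) memvB ?memv_projC.
have memq x : q x \in (W^C)%VS by rewrite qE memv_projC.
pose p (v : vquot) : subvs_of W^C := vsproj W^C (q (repr v)).
have pE x : p (\pi x) = vsproj W^C (q x).
  rewrite /p; congr vsproj; apply/esym/eqP.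
  by rewrite -subr_eq0 -linearB /= qW ?vquot_repr_sub.
have p_lin : linear p.
  move=> a u v; rewrite -[u]reprK -[v]reprK -vquot_pi_is_linear !pE.
  by rewrite !linearP.
have p_bij : bijective p.
  exists (fun w => \pi_vquot (vsval w)) => [v|w]; last first.
    by rewrite pE qWC ?subvsP // vsvalK.
  rewrite /p vsprojK ?memq // -[RHS]reprK; apply/eqP.
  by rewrite vquot_piE qE addrAC subrr sub0r memvN memv_proj.
have [v2r v2r_lin v2r_bij] := @subvs_vect_iso _ _ (W^C)%VS.
exists (v2r \o p); last exact: bij_comp.
by move=> a u v; rewrite /= p_lin v2r_lin.
Qed.

HB.instance Definition _ := Lmodule_hasFinDim.Build F vquot vquot_vect_iso.

End QuotientSpace.
Section LieAlgebra.
Variables (F : fieldType) (vT : vectType F).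
Implicit Types (f g : 'End(vT)) (U V L : {vspace 'End(vT)}).

(* The parentheses matter: \o and - have the same level. *)
Definition lie_br f g : 'End(vT) := (f \o g)%VF - (g \o f)%VF.

Definition lie_brv U V : {vspace 'End(vT)} :=
  <<[seq lie_br f g | f <- vbasis U, g <- vbasis V]>>%VS.

Definition derived_series L n : {vspace 'End(vT)} :=
  iter n (fun U => lie_brv U U) L.

Definition lie_solvable L : Prop := exists n, derived_series L n = 0%VS.

Lemma lie_brE f g v : lie_br f g v = f (g v) - g (f v).
Proof. by rewrite /lie_br add_lfunE opp_lfunE !comp_lfunE. Qed.

Lemma lie_brC f g : lie_br f g = - lie_br g f.
Proof. by rewrite /lie_br opprB. Qed.

Fact lie_br_is_linear f : linear (lie_br f).
Proof.
move=> a g h; apply/lfunP=> v; rewrite !(lie_brE, add_lfunE, scale_lfunE) linearP /=.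
by rewrite scalerBr opprD addrACA.
Qed.
HB.instance Definition _ f :=
  GRing.isLinear.Build F 'End(vT) 'End(vT) _ (lie_br f) (lie_br_is_linear f).

Lemma lie_brvP U V L :
  reflect {in U & V, forall f g, lie_br f g \in L} (lie_brv U V <= L)%VS.
Proof.
apply: (iffP idP) => [sL f g Uf Vg | sUVL]; last first.
  apply/span_subvP=> _ /allpairsP[[f g] /= [Uf Vg ->]].
  by rewrite sUVL ?vbasis_mem.
apply: (subvP sL); rewrite (coord_vbasis Vg) linear_sum.
apply: rpred_sum => j _; rewrite linearZ rpredZ //= lie_brC rpredN.
rewrite (coord_vbasis Uf) linear_sum.
apply: rpred_sum => i _; rewrite linearZ rpredZ //= lie_brC rpredN.
apply/memv_span/allpairsP; exists ((vbasis U)`_i, (vbasis V)`_j).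
by rewrite !mem_nth ?size_tuple.
Qed.

End LieAlgebra.

Section LocalAlgebra.
Variables (F : fieldType) (A : comFalgType F).
Implicit Types (I J m : {vspace A}) (a b s x : A) (xi : 'End(A)) (r : nat).

(* A is unital, so every ring-theoretic ideal of A is a linear subspace. *)
Definition ideal I : Prop := forall a x, x \in I -> a * x \in I.

Definition maximal_ideal I : Prop :=
  [/\ ideal I, I != fullv &
      forall J, ideal J -> (I <= J)%VS -> J = I \/ J = fullv].

Definition local_with m : Prop := unique maximal_ideal m.

(* It suffices to annihilate a basis of m, see socP. *)
Definition soc m : {vspace A} :=
  (m :&: \bigcap_i lker (amulr (tnth (vbasis m) i)))%VS.

Lemma socP m a :
  reflect (a \in m /\ {in m, forall x, a * x = 0}) (a \in soc m).
Proof.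
rewrite memv_cap; apply: (iffP andP) => -[ma sa]; split=> //.
  move=> x /coord_vbasis->; rewrite mulr_sumr big1 // => i _.
  rewrite -scalerAr -tnth_nth; move/subv_bigcapP: sa => /(_ i isT).
  by rewrite -memvE memv_ker lfunE /= => /eqP->; rewrite scaler0.
apply/subv_bigcapP => i _; rewrite -memvE memv_ker lfunE /=.
by apply/eqP/sa/vbasis_mem/mem_tnth.
Qed.

Definition gorenstein m : Prop := \dim (soc m) = 1%N.

Definition nil_index m r : Prop := (m ^+ r)%VS <> 0%VS /\ (m ^+ r.+1)%VS = 0%VS.

Definition leibniz_defect a b xi : A := xi (a * b) - (xi a * b + a * xi b).

Fact leibniz_defect_is_linear a b : linear (leibniz_defect a b).
Proof.
move=> c f g; rewrite /leibniz_defect !(add_lfunE, scale_lfunE) mulrDl mulrDr.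
by rewrite -scalerAl -scalerAr addrACA -scalerDr opprD addrACA -scalerBr.
Qed.
HB.instance Definition _ a b := GRing.isLinear.Build F 'End(A) A _
  (leibniz_defect a b) (leibniz_defect_is_linear a b).

(* Leibniz rule on a basis; DerP gives it on all of A. *)
Definition Der : {vspace 'End(A)} :=
  (\bigcap_(p : 'I_(\dim {:A}) * 'I_(\dim {:A}))
     lker (linfun (leibniz_defect (tnth (vbasis {:A}) p.1)
                                  (tnth (vbasis {:A}) p.2))))%VS.

Lemma DerP xi :
  reflect (forall a b, xi (a * b) = xi a * b + a * xi b) (xi \in Der).
Proof.
apply: (iffP subv_bigcapP) => [dxi a b | dxi p _]; last first.
  by rewrite -memvE memv_ker lfunE /= /leibniz_defect dxi subrr.
rewrite (coord_vbasis (memvf a)) (coord_vbasis (memvf b)).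
rewrite !(mulr_sumr, linear_sum) -big_split; apply: eq_bigr => /= j _.
rewrite !mulr_suml linear_sum -big_split; apply: eq_bigr => /= i _.
rewrite !(=^~ scalerAl, linearZZ) -!scalerAr linearZZ -!scalerDr !scalerA /=.
congr (_ *: _); have := dxi (i, j) isT.
by rewrite -memvE memv_ker lfunE /= /leibniz_defect subr_eq0 !(tnth_nth 0) => /eqP.
Qed.

Lemma Der_lie : (lie_brv Der Der <= Der)%VS.
Proof.
apply/lie_brvP => f g /DerP df /DerP dg; apply/DerP => a b.
by rewrite !lie_brE df dg !linearD /= !(df, dg); ring.
Qed.

(* m ^ 2 is pulled back along subvs_of m -> A to a subspace of subvs_of m. *)
Definition cotangent m : Type :=
  vquot (linfun (vsval : subvs_of m -> A) @^-1: (m ^+ 2))%VS.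
HB.instance Definition _ m := Vector.on (cotangent m).
HB.instance Definition _ m := EqQuotient.on (cotangent m).

Lemma cotangent_piE m (x y : subvs_of m) :
  (\pi_(cotangent m) x == \pi_(cotangent m) y) =
  (vsval x - vsval y \in (m ^+ 2)%VS).
Proof. by rewrite vquot_piE -memv_preim lfunE. Qed.

(* The map induced by xi on m / m ^ 2. It is written with representatives,
   since linfun and vsproj (the projection onto m) are total; rhoE shows that
   for a derivation neither the representative nor the projection matters. *)
Definition rho m xi : 'End(cotangent m) :=
  linfun (fun v : cotangent m =>
            \pi_(cotangent m) (vsproj m (xi (vsval (repr v))))).

(* The coordinate on s of the r-th power of a representative; the defining
   identity x ^+ r = P (\pi x) *: s is index_polyE. *)
Definition index_poly m r s (v : cotangent m) : F :=
  coord [tuple s] ord0 (vsval (repr v) ^+ r).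

(* r is determined by m, and s is any nonzero element of the socle: another
   choice of s rescales the index polynomial by a nonzero constant. *)
Definition full_null_index m : Prop :=
  forall r s, nil_index m r -> s \in soc m -> s != 0 ->
  forall xi, xi \in Der -> xi != 0 ->
  forall lambda : F, leigenvalue (rho m xi) lambda ->
  exists v, [/\ v \in leigenspace (rho m xi) lambda, v != 0 &
                index_poly r s v != 0].

Lemma memvXn m x n : x \in m -> x ^+ n \in (m ^+ n)%VS.
Proof.
move=> xm; elim: n => [|n IHn]; first by rewrite expr0 expv0 memv_line.
by rewrite exprS expvSl memv_mul.
Qed.

Lemma nil_indexX m r x : nil_index m r -> x \in m -> x ^+ r.+1 = 0.
Proof. by case=> _ m0 /(@memvXn _ _ r.+1); rewrite m0 memv0 => /eqP. Qed.

Lemma ideal_expv m n : ideal m -> (m ^+ n.+1 <= m)%VS.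
Proof.
move=> im; elim: n => [|n IHn]; first by rewrite expv1.
by rewrite expvSl; apply/prodvP => u v _ /(subvP IHn); apply: im.
Qed.

Lemma soc_line m s : gorenstein m -> s \in soc m -> s != 0 ->
  soc m = <[s]>%VS.
Proof.
move=> gm sm s0; apply/esym/eqP.
by rewrite eqEdim -memvE sm dim_vline s0 gm.
Qed.

Lemma index_polyE m r s (x : subvs_of m) :
    ideal m -> gorenstein m -> nil_index m r -> s \in soc m -> s != 0 ->
  vsval x ^+ r = index_poly r s (\pi_(cotangent m) x) *: s.
Proof.
move=> im gm hr sm s0; case: (hr) => _ m0.
case: r => [|r] in hr m0 *.
  have /socP[sm' _] := sm; rewrite expv1 in m0.
  by rewrite m0 memv0 (negPf s0) in sm'.
have -> : vsval x ^+ r.+1 = vsval (repr (\pi_(cotangent m) x)) ^+ r.+1.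
  apply/eqP; rewrite -subr_eq0 subrXX -memv0 -m0 -addn2 addnC expvD memv_mul //.
    by rewrite -cotangent_piE reprK.
  apply: rpred_sum => i _ /=.
  rewrite -[r in (m ^+ r)%VS](subnK (leq_ord i)) expvD.
  by rewrite memv_mul ?memvXn ?subvsP.
set y := repr _; have : vsval y ^+ r.+1 \in soc m.
  apply/socP; split.
    by apply: (subvP (ideal_expv r im)); rewrite memvXn ?subvsP.
  move=> z zm; apply/eqP; rewrite -memv0 -m0 expvSr.
  by rewrite memv_mul ?memvXn ?subvsP.
rewrite (soc_line gm sm s0) -span_seq1 => /(@coord_span _ _ _ [tuple s]).
by rewrite big_ord1 /index_poly.
Qed.

Lemma local_nonunit m r x :
  local_with m -> nil_index m r -> x \notin m -> x \is a GRing.unit.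
Proof.
move=> [[im mT maxm] _] hr xm.
have iJ : ideal (m + limg (amulr x))%VS.
  move=> a _ /memv_addP[u um [_ /memv_imgP[b _ ->] ->]].
  rewrite mulrDr memv_add ?im // lfunE /= mulrA.
  by apply/memv_imgP; exists (a * b); rewrite ?memvf // lfunE.
have xJ : x \in (m + limg (amulr x))%VS.
  apply: (subvP (addvSr _ _)); apply/memv_imgP.
  by exists 1; rewrite ?memvf // lfunE /= mul1r.
case: (maxm _ iJ (addvSl _ _)) => [Jm|JT]; first by rewrite -Jm xJ in xm.
have := memvf (1 : A); rewrite -JT.
case/memv_addP=> u um [_ /memv_imgP[b _ ->]]; rewrite lfunE /= => def1.
have : b * x * (\sum_(i < r.+1) u ^+ i) = 1.
  have -> : b * x = 1 - u by rewrite def1 addrC addKr.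
  by rewrite -[LHS]opprK -mulNr opprB -subrX1 (nil_indexX hr um) sub0r opprK.
move=> bx1; apply/unitrP; exists (b * \sum_(i < r.+1) u ^+ i).
by split; rewrite -bx1; ring.
Qed.

Lemma DerX xi x n : xi \in Der -> xi (x ^+ n.+1) = (x ^+ n * xi x) *+ n.+1.
Proof.
move/DerP=> dxi; elim: n => [|n IHn]; first by rewrite expr1 expr0 mul1r.
by rewrite exprS dxi IHn mulrnAr mulrA -exprS [xi x * _]mulrC -mulrS.
Qed.

Lemma Der_max_ideal m r xi x :
    [pchar F] =i pred0 -> local_with m -> nil_index m r -> xi \in Der ->
  x \in m -> xi x \in m.
Proof.
move=> F0 lm hr dxi xm; apply: contraT => /(local_nonunit lm hr) xi_unit.
have {hr} : x ^+ r.+1 = 0 by apply: nil_indexX xm.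
elim: r.+1 => [/eqP|n IHn xn0]; first by rewrite expr0 oner_eq0.
apply: IHn; have := DerX x n dxi; rewrite xn0 linear0 => /esym/eqP.
rewrite -scaler_nat scaler_eq0 ((pcharf0P F).1 F0) orFb.
by move=> /eqP/(congr1 (fun z => z / xi x)); rewrite mulrK // mul0r.
Qed.

Lemma rhoE m r xi (x : subvs_of m) :
    [pchar F] =i pred0 -> local_with m -> nil_index m r -> xi \in Der ->
  rho m xi (\pi_(cotangent m) x) = \pi_(cotangent m) (vsproj m (xi (vsval x)))
  /\ vsval (vsproj m (xi (vsval x))) = xi (vsval x).
Proof.
move=> F0 lm hr dxi.
have xim y : y \in m -> xi y \in m by apply: Der_max_ideal F0 lm hr dxi.
have xim2 y : y \in (m ^+ 2)%VS -> xi y \in (m ^+ 2)%VS.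
  suff /subvP/(_ y) s2 : (m ^+ 2 <= xi @^-1: (m ^+ 2))%VS.
    by move/s2; rewrite -memv_preim.
  rewrite expv2; apply/prodvP => u v um vm; rewrite -memv_preim.
  by move/DerP: (dxi) ->; rewrite memvD // memv_mul ?xim.
split; last by rewrite vsprojK ?xim ?subvsP.
rewrite /rho; set f := (X in linfun X).
have fE z : f (\pi z) = \pi_(cotangent m) (vsproj m (xi (vsval z))).
  apply/eqP; rewrite cotangent_piE !vsprojK ?xim ?subvsP // -linearB xim2 //.
  by rewrite -cotangent_piE reprK.
have f_lin : linear f.
  move=> a u v; rewrite -[u]reprK -[v]reprK -[_ + _]vquot_pi_is_linear !fE.
  by rewrite !linearP; apply: vquot_pi_is_linear.
pose g : {linear cotangent m -> cotangent m} :=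
  HB.pack f (GRing.isLinear.Build F (cotangent m) (cotangent m) *:%R f f_lin).
by rewrite -fE -[f]/(g : _ -> _) lfunE.
Qed.

End LocalAlgebra.

(* Main.v *)
(* Let s span the socle and let xi be a derivation, so that xi s = chi(xi) s.
   If v = pi(x) is an eigenvector of rho(xi) for lambda with P(v) != 0, then
   applying xi to x^r = P(v) s gives r lambda x^r = chi(xi) x^r. Full null-index
   thus forces every eigenvalue of rho(xi) to be chi(xi) / r. Since chi vanishes
   on [Der A, Der A], a derivation there is nilpotent on m / m^2, hence on A by
   the Leibniz rule. By Engel's theorem [Der A, Der A] is a nilpotent Lie
   algebra, so Der A is solvable. *)
From HB Require Import structures.
Require Import Defs.
From mathcomp Require Import all_boot all_order all_algebra.
From mathcomp Require Import generic_quotient falgebra.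
From mathcomp Require Import reals complex.
From mathcomp Require Import boolp zify.

Set Implicit Arguments.
Unset Strict Implicit.
Unset Printing Implicit Defensive.

Import GRing.Theory Num.Theory.
Import FalgLfun passmx.
Local Open Scope ring_scope.
Local Open Scope quotient_scope.

(** * Engel's theorem inside an associative algebra *)

Section Engel.
Variables (F : fieldType) (B : falgType F).
Implicit Types (K L : {vspace B}) (x y : B).

(** Lie subalgebras of [B]; the ambient product lets nilpotency be measured by the powers
    [L ^+ n]. *)
Definition bracket_closed L := {in L &, forall x y, x * y - y * x \in L}.

Lemma expv_adjoin_nilpotent K x n p :
    {in K, forall k, k * x - x * k \in K} -> (K ^+ n)%VS = 0%VS -> x ^+ p = 0 ->
  ((K + <[x]>) ^+ (p * n))%VS = 0%VS.
Proof.
(* With G the unital algebra generated by K and x, the right ideal K * G is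
   two-sided, and it is nilpotent because K is; modulo it M ^+ k is spanned by
   x ^+ k. *)
move=> Kx Kn xp; set M := (K + <[x]>)%VS.
pose G := agenv M; pose J := (K * G)%VS.
have sKM : (K <= M)%VS by apply: addvSl.
have sMG : (M <= G)%VS by apply: sub_agenv.
have sKJ : (K <= J)%VS by rewrite -{1}[K]prodv1 prodvSr ?sub1_agenv.
have GG : (G * G)%VS = G by apply: agenvM.
have MJ : (M * J <= J)%VS.
  rewrite /J prodvA -{2}GG prodvA prodvSl // prodvDl subv_add.
  rewrite prodvSr ?(subv_trans sKM) //=; apply/prodvP => _ k /vlineP[c ->] Kk.
  rewrite -scalerAl rpredZ // -[x * k](subKr (k * x)) memvB //.
    rewrite memv_mul // (subvP sMG) // (subvP (addvSr _ _)) //.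
    exact: memv_line.
  by rewrite (subvP sKJ) ?Kx.
have GJ : (G * J <= J)%VS by apply: agenv_modl.
(* Powers of [K] move left past [G], so the positive powers of [J] collapse into [K ^+ k * G]. *)
have GK k : (G * K ^+ k <= K ^+ k * G)%VS.
  elim: k => [|k IHk]; first by rewrite expv0 prodv1 prod1v.
  have GK1 : (G * K <= K * G)%VS by apply: subv_trans GJ; apply: prodvSr.
  rewrite expvSl prodvA; apply: subv_trans (prodvSl _ GK1) _.
  by rewrite -!prodvA prodvSr.
have Jk k : (J ^+ k.+1 <= K ^+ k.+1 * G)%VS.
  elim: k => [|k IHk]; first by rewrite !expv1.
  rewrite expvSl; apply: subv_trans (prodvSr _ IHk) _.
  rewrite /J -prodvA prodvA -prodvA.
  have -> : (K ^+ k.+2 * G = K * (K ^+ k.+1 * G) * G)%VS.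
    by rewrite expvSl -!prodvA GG.
  by rewrite !prodvA prodvSl // -!prodvA prodvSr // !prodvA -prodvA.
have Mk k : (M ^+ k <= <[x ^+ k]> + J)%VS.
  elim: k => [|k IHk]; first by rewrite expv0 expr0 addvSl.
  rewrite expvSl; apply: subv_trans (prodvSr _ IHk) _.
  rewrite prodvDr subv_add (subv_trans MJ (addvSr _ _)) andbT.
  rewrite prodvDl prodv_line -exprS subv_add addvSl andbT.
  apply: subv_trans (addvSr _ _); apply: prodvSr.
  by apply: subv_trans (subX_agenv _ k); rewrite -expv_line expvS ?addvSr.
apply/eqP; rewrite -subv0 expvM; case: n => [|n] in Kn *.
  by move/eqP: Kn; rewrite expv0 (negPf (vspace1_neq0 _)).
have MJp : (M ^+ p <= J)%VS.
  by apply: subv_trans (Mk p) _; rewrite xp subv_add subvv andbT -memvE mem0v.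
by apply: subv_trans (expvS _ MJp) (subv_trans (Jk n) _); rewrite Kn prod0v.
Qed.

Lemma proper_normalizer K L n :
    (K <= L)%VS -> L != K -> bracket_closed L -> (K ^+ n)%VS = 0%VS ->
  exists x, [/\ x \in L, x \notin K & {in K, forall k, k * x - x * k \in K}].
Proof.
move=> sKL neqLK LL Kn.
have K0 a : (n <= a)%N -> (K ^+ a)%VS = 0%VS.
  by move=> na; rewrite -(subnKC na) expvD Kn prod0v.
have /subvPn[x0 Lx0 Kx0] : ~~ (L <= K)%VS.
  by apply: contraNN neqLK => sLK; rewrite eqEsubv sLK.
(* The two-sided products of x with j powers of K vanish; replacing x by a
   bracket [k, x] outside K lowers j, and j = 0 would give x = 0. *)
suff main j x : x \in L -> x \notin K ->
    (forall a b u v, (j <= a + b)%N -> u \in (K ^+ a)%VS -> v \in (K ^+ b)%VS ->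
      u * x * v = 0) ->
    exists y, [/\ y \in L, y \notin K & {in K, forall k, k * y - y * k \in K}].
  (* If [a + b >= n + n], then [a >= n] or [b >= n], and that power of [K] vanishes. *)
  apply: (main (n + n)%N x0) => // a b u v le_ab.
  have [/K0-> | lt_an] := leqP n a.
    by rewrite memv0 => /eqP->; rewrite !mul0r.
  have [/K0-> _ | lt_bn] := leqP n b.
    by rewrite memv0 => /eqP->; rewrite mulr0.
  by have := leq_add lt_an (ltnW lt_bn); rewrite addSn ltnNge le_ab.
elim: j x => [|j IHj] x Lx Kx xj.
  have := xj 0%N 0%N 1 1 isT; rewrite !expv0 mulr1 mul1r => x0'.
  by rewrite x0' ?mem0v ?memv_line in Kx.
have [/subvP sK | ] := boolP ((amulr x - amull x)%VF @: K <= K)%VS.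
  exists x; split=> // k Kk; have := sK _ (memv_img (amulr x - amull x) Kk).
  by rewrite add_lfunE opp_lfunE !lfunE.
case/subvPn=> _ /memv_imgP[k Kk ->].
rewrite add_lfunE opp_lfunE !lfunE /= => Ky.
apply: IHj Ky _ => [|a b u v le_ab Ku Kv]; first by rewrite LL // (subvP sKL).
(* In [u * (k * x - x * k) * v] the factor [k] is absorbed by [u] or by [v], which raises [a + b] by
   one. *)
have Kuk : u * k \in (K ^+ a.+1)%VS by rewrite expvSr memv_mul.
have Kkv : k * v \in (K ^+ b.+1)%VS by rewrite expvSl memv_mul.
rewrite mulrBr mulrBl !mulrA -(mulrA (u * x)).
by rewrite (xj a.+1 b (u * k)) ?(xj a b.+1 u (k * v)) ?subrr ?addnS ?addSn.
Qed.

(* Engel's theorem in Jacobson's form: a subalgebra of maximal dimension among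
   those with K ^+ n = 0 would be enlarged by an element of its normaliser. *)
Lemma engel_expv L :
    bracket_closed L -> {in L, forall x, exists p, x ^+ p = 0} ->
  exists n, (L ^+ n)%VS = 0%VS.
Proof.
move=> LL nilL.
(* Induction on a bound [d] for the codimension of [K] in [L], starting from [K = 0]. *)
suff main d K n : (\dim L - \dim K <= d)%N -> (K <= L)%VS -> bracket_closed K ->
    (K ^+ n)%VS = 0%VS -> exists n, (L ^+ n)%VS = 0%VS.
  apply: (main _ 0%VS 1%N (leqnn _)); rewrite ?sub0v ?expv1 // => x y.
  by rewrite !memv0 => /eqP-> /eqP->; rewrite mulr0 subrr.
elim: d K n => [|d IHd] K n le_d sKL KK Kn; have [LK | neqLK] := eqVneq L K.
- by exists n; rewrite LK.
- by case/eqP: neqLK; apply/esym/eqP; rewrite eqEdim sKL -subn_eq0 -leqn0.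
- by exists n; rewrite LK.
have [x [Lx Kx Nx]] := proper_normalizer sKL neqLK LL Kn.
have [p xp] := nilL x Lx.
apply: IHd (expv_adjoin_nilpotent Nx Kn xp).
- have : (\dim K < \dim (K + <[x]>))%N.
    rewrite ltn_neqAle dimvS ?addvSl // andbT; apply: contraNneq Kx => eqd.
    have /eqP-> : K == (K + <[x]>)%VS by rewrite eqEdim addvSl -eqd leqnn.
    by rewrite (subvP (addvSr _ _)) ?memv_line.
  by lia.
- by rewrite subv_add sKL -memvE.
move=> _ y /memv_addP[k Kk [_ /vlineP[c ->] ->]].
case/memv_addP=> [l Kl [_ /vlineP[e ->] ->]].
have cxex : c *: x * (e *: x) = e *: x * (c *: x).
  by rewrite -!scalerAl -!scalerAr !scalerA mulrC.
(* The bracket of [x] with itself drops out; what remains lies in [K] because [K] is closed and [x]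
   normalises it. *)
have -> : (k + c *: x) * (l + e *: x) - (l + e *: x) * (k + c *: x)
    = (k * l - l * k) + e *: (k * x - x * k) - c *: (l * x - x * l).
  rewrite !mulrDl !mulrDr cxex !scalerBr (scalerAr e k x) (scalerAl e x k).
  rewrite (scalerAr c l x) (scalerAl c x l).
  rewrite opprB !opprD !addrA.
  by rewrite [LHS](ACl (4 * 8 * 1 * 5 * 2 * 7 * 3 * 6)%AC) /= subrr add0r.
apply: (subvP (addvSl _ _)).
apply: memvB; last by rewrite rpredZ ?Nx.
by apply: memvD; [apply: KK | rewrite rpredZ ?Nx].
Qed.

End Engel.

(** * Split annihilating polynomials and local algebras *)

Lemma split_annihilator (F : closedFieldType) (B : falgType F) (t : B) :
  exists s : seq F, \prod_(c <- s) (t - c%:A) = 0.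
Proof.
(* The [n + 1] powers of [t] outnumber the dimension; a dependence among them is a nonzero
   polynomial killing [t], which splits over [F]. *)
pose n := \dim {:B}; pose X := [tuple t ^+ i | i < n.+1].
have /freeP nfX : ~~ free X.
  rewrite /free size_tuple; apply: contraTN isT => /eqP dX.
  by have := dimvS (subvf <<X>>); rewrite dX ltnn.
have [k Xk [i ki]] : exists2 k : 'I_n.+1 -> F,
    \sum_(i < n.+1) k i *: X`_i = 0 & exists i, k i != 0.
  apply: contra_notP nfX => nk k Xk i; apply/eqP/contraT => ki.
  by case: nk; exists k => //; exists i.
pose p := \poly_(i < n.+1) k (inord i).
have p0 : p != 0.
  apply: contraNneq ki => /polyP/(_ i).
  by rewrite coef_poly ltn_ord coef0 inord_val => ->.
have [s def_p] := closed_field_poly_normal p.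
exists s; have : horner_alg t p = 0.
  rewrite -[RHS]Xk /p poly_def linear_sum; apply: eq_bigr => j _.
  rewrite -tnth_nth tnth_mktuple linearZ /= rmorphXn /= horner_algX inord_val.
  by rewrite mulr_algl.
rewrite def_p linearZ /= mulr_algl rmorph_prod => /eqP.
rewrite scaler_eq0 lead_coef_eq0 (negPf p0) => /eqP eq0; rewrite -[RHS]eq0.
by apply: eq_bigr => c _; rewrite rmorphB /= horner_algX horner_algC.
Qed.

Lemma ideal_full (F : fieldType) (A : comFalgType F) (I : {vspace A}) :
  ideal I -> 1 \in I -> I = fullv.
Proof.
move=> iI I1; apply/eqP; rewrite eqEsubv subvf.
by apply/subvP=> x _; rewrite -[x]mulr1 iI.
Qed.

Section LocalAlgebra.
Variables (F : fieldType) (A : comFalgType F) (m : {vspace A}).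
Hypothesis lm : local_with m.
Implicit Types (x y : A) (I : {vspace A}).

Lemma local_ideal : ideal m. Proof. by case: lm => -[]. Qed.

Lemma local_notin1 : 1 \notin m.
Proof.
case: lm => -[im mT _] _; apply: contraNN mT => m1.
exact/eqP/ideal_full.
Qed.

(** By finite dimension, a proper ideal can be enlarged only finitely often before it is maximal,
    hence equal to [m]. *)
Lemma proper_ideal_sub I : ideal I -> 1 \notin I -> (I <= m)%VS.
Proof.
have [d] := ubnP (\dim (@fullv F A) - \dim I)%N.
elim: d I => // d IHd I le_d iI I1.
have [[J [iJ sIJ nJI J1]] | noJ] :=
  EM (exists J, [/\ ideal J, (I <= J)%VS, J != I & 1 \notin J]).
  apply: subv_trans (sIJ) _; apply: IHd => //.
  have ltIJ : (\dim I < \dim J)%N.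
    rewrite ltn_neqAle dimvS // andbT; apply: contraNneq nJI => eqd.
    by rewrite eq_sym eqEdim sIJ -eqd leqnn.
  by have := dimvS (subvf J); lia.
case: lm => _ /(_ I) -> //; split=> // [|J iJ sIJ].
  by apply: contraNneq I1 => ->; rewrite memvf.
have [->|nJI] := eqVneq J I; [by left | right].
by apply: ideal_full => //; apply: contraT => J1; case: noJ; exists J.
Qed.

(** A non-unit generates a proper ideal. Unlike [local_nonunit], this does not presuppose a
    nilpotent [m], and so can serve to prove nilpotency. *)
Lemma unit_notin x : x \notin m -> x \is a GRing.unit.
Proof.
move=> mx; have ix : ideal (limg (amulr x)).
  move=> a _ /memv_imgP[b _ ->]; rewrite lfunE /= mulrA.
  by apply/memv_imgP; exists (a * b); rewrite ?memvf // lfunE.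
have [/memv_imgP[y _ def1] | x1] := boolP (1 \in limg (amulr x)).
  rewrite lfunE /= in def1; apply/unitrP; exists y.
  by rewrite [x * y]mulrC -def1.
case/negP: mx; apply: (subvP (proper_ideal_sub ix x1)).
by apply/memv_imgP; exists 1; rewrite ?memvf // lfunE /= mul1r.
Qed.

End LocalAlgebra.

Section ClosedLocalAlgebra.
Variables (F : closedFieldType) (A : comFalgType F) (m : {vspace A}).
Hypothesis lm : local_with m.

(** Among the factors of a vanishing product of [x - c%:A], those outside [m] are units. Cancelling
    them all would give [1 = 0]. *)
Lemma local_decomp x : exists c, x - c%:A \in m.
Proof.
have [s] := split_annihilator x; elim: s => [|c s IHs].
  by rewrite big_nil => /eqP; rewrite oner_eq0.
rewrite big_cons; have [mx _ | /(unit_notin lm) ux] := boolP (x - c%:A \in m).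
  by exists c.
by move/(congr1 (fun y => (x - c%:A)^-1 * y)); rewrite mulKr // mulr0.
Qed.

(** In a vanishing product of [x - c%:A], the factors with [c != 0] are units and cancel; the others
    accumulate in a power of [x]. *)
Lemma local_nilpotent x : x \in m -> exists p, x ^+ p = 0.
Proof.
move=> mx; have [s sx] := split_annihilator x.
have: x ^+ 0 * \prod_(c <- s) (x - c%:A) = 0 by rewrite sx mulr0.
elim: s {sx} 0%N => [|c s IHs] k.
  by rewrite big_nil mulr1 => xk; exists k.
rewrite big_cons mulrCA; have [-> | c0] := eqVneq c 0.
  by rewrite scale0r subr0 mulrA -exprS; apply: IHs.
have ux : x - c%:A \is a GRing.unit.
  apply: (unit_notin lm); apply: contra (local_notin1 lm) => mxc.
  by rewrite -[1](scalerK c0) memvZ // -[_ *: _](subKr x) memvB ?mxc.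
move/(congr1 (fun y => (x - c%:A)^-1 * y)); rewrite mulKr // mulr0; exact: IHs.
Qed.

(** Brackets vanish in the commutative [A], so Engel's theorem applies to [m] itself. *)
Lemma nil_index_ex : exists r, nil_index m r.
Proof.
have [|_ /local_nilpotent//|n mn] := @engel_expv _ _ m.
  by move=> x y _ _; rewrite mulrC subrr mem0v.
have exn : exists n, (m ^+ n)%VS == 0%VS by exists n; apply/eqP.
case: (ex_minnP exn) => -[|r] /eqP mr min_r.
  by have := vspace1_neq0 A; rewrite -mr expv0 eqxx.
by exists r; split=> // /eqP/min_r; rewrite ltnn.
Qed.

End ClosedLocalAlgebra.


(** A bracket is a difference of two products, so each derived step doubles the associative
    degree. *)
Lemma derived_series_expv (F : fieldType) (A : falgType F)
    (L : {vspace 'End(A)}) k :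
  (derived_series L k <= L ^+ (2 ^ k))%VS.
Proof.
elim: k => [|k IHk]; first by rewrite expv1.
apply/lie_brvP=> f g /(subvP IHk) Lf /(subvP IHk) Lg.
by rewrite expnS mul2n -addnn expvD memvB // memv_mul.
Qed.

Lemma leigenspaceP (F : fieldType) (vT : vectType F) (f : 'End(vT)) a v :
  (v \in leigenspace f a) = (f v == a *: v).
Proof.
by rewrite memv_ker add_lfunE opp_lfunE scale_lfunE id_lfunE subr_eq0.
Qed.

(** * Derivations on the powers of [m], on [m / m ^ 2] and on the socle *)

Section Derivations.
Variables (F : fieldType) (A : comFalgType F) (m : {vspace A}) (r : nat).
Hypotheses (F0 : [pchar F] =i pred0) (lm : local_with m) (hr : nil_index m r).
Implicit Types (x y : A) (xi : 'End(A)) (n k : nat).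

Let Der_max xi x : xi \in Der A -> x \in m -> xi x \in m.
Proof. exact: Der_max_ideal F0 lm hr. Qed.

Lemma Der1 xi : xi \in Der A -> xi 1 = 0.
Proof.
move/DerP/(_ 1 1); rewrite !mulr1 mul1r -[LHS]addr0.
by move/addrI/esym.
Qed.

Lemma Der_expv xi n x :
  xi \in Der A -> x \in (m ^+ n.+1)%VS -> xi x \in (m ^+ n.+1)%VS.
Proof.
move=> dxi; elim: n x => [|n IHn] x; first by rewrite expv1; apply: Der_max.
suff /subvP/(_ x) s : (m ^+ n.+2 <= xi @^-1: (m ^+ n.+2))%VS.
  by move/s; rewrite -memv_preim.
rewrite expvSl; apply/prodvP => u v um vm; rewrite -memv_preim.
by move/DerP: (dxi) ->; rewrite memvD // memv_mul ?Der_max ?IHn.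
Qed.

Lemma Der_iter_expv xi n k x :
  xi \in Der A -> x \in (m ^+ n.+1)%VS -> (xi ^+ k) x \in (m ^+ n.+1)%VS.
Proof.
move=> dxi; elim: k x => [|k IHk] x mx; first by rewrite expr0 id_lfunE.
by rewrite exprS lfun_mulE IHk ?Der_expv.
Qed.

(** The iterated Leibniz rule without binomial coefficients. *)
Lemma Der_iter_mul (T : {vspace A}) xi n x y : xi \in Der A ->
    (forall a b, (n <= a + b)%N -> (xi ^+ a) x * (xi ^+ b) y \in T) ->
  (xi ^+ n) (x * y) \in T.
Proof.
move=> dxi; elim: n x y => [|n IHn] x y xyT.
  by have := xyT 0 0 isT; rewrite !expr0 !id_lfunE.
rewrite exprS lfun_mulE; move/DerP: (dxi) ->; rewrite linearD.
apply: memvD; apply: IHn => a b le_n.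
  by have := xyT a.+1 b; rewrite exprS lfun_mulE; apply.
by have := xyT a b.+1; rewrite exprS lfun_mulE addnS; apply.
Qed.

Lemma Der_nilpotent_max xi k : xi \in Der A ->
    {in m, forall x, (xi ^+ k) x \in (m ^+ 2)%VS} ->
  exists n, {in m, forall x, (xi ^+ n) x = 0}.
Proof.
move=> dxi nil2.
have step j : exists q,
    {in (m ^+ j.+1)%VS, forall x, (xi ^+ q) x \in (m ^+ j.+2)%VS}.
  elim: j => [|j [q nilj]]; first by exists k.
  exists (k + q)%N => x.
  suff /subvP/(_ x) s : (m ^+ j.+2 <= (xi ^+ (k + q))%R @^-1: (m ^+ j.+3))%VS.
    by move/s; rewrite -memv_preim.
  rewrite expvSl; apply/prodvP => u w um wm; rewrite -memv_preim.
  apply: Der_iter_mul => // a b le_ab.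
  (* Since [a + b >= k + q], either [a >= k] pushes [u] into [m ^ 2], or [b >= q] pushes [w] one
     power deeper. *)
  have [le_k | lt_k] := leqP k a.
    have -> : (m ^+ j.+3 = m ^+ 2 * m ^+ j.+1)%VS by rewrite -expvD.
    apply: memv_mul; last exact: Der_iter_expv.
    rewrite -(subnK le_k) exprD lfun_mulE nil2 //.
    by rewrite -[m]expv1 Der_iter_expv ?expv1.
  have le_q : (q <= b)%N by lia.
  rewrite expvSl memv_mul //.
    by rewrite -[m]expv1 Der_iter_expv ?expv1.
  by rewrite -(subnK le_q) exprD lfun_mulE nilj ?Der_iter_expv.
have all_steps j : exists q, {in m, forall x, (xi ^+ q) x \in (m ^+ j.+1)%VS}.
  elim: j => [|j [q nilj]].
    by exists 0%N => x mx; rewrite expr0 id_lfunE expv1.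
  have [p nilp] := step j; exists (q + p)%N => x mx.
  by rewrite exprD lfun_mulE nilp ?nilj.
have [q nilq] := all_steps r; exists q => x /nilq.
by case: hr => _ ->; rewrite memv0 => /eqP.
Qed.

Lemma eigen_cotangent xi x c :
    xi \in Der A -> x \in m -> x \notin (m ^+ 2)%VS ->
    xi x - c *: x \in (m ^+ 2)%VS ->
  leigenvalue (rho m xi) c.
Proof.
move=> dxi mx m2x m2xc; pose u := vsproj m x.
have ux : vsval u = x by rewrite vsprojK.
have [rho_u xi_u] := rhoE u F0 lm hr dxi.
have piZ a : a *: \pi_(cotangent m) u = \pi_(cotangent m) (a *: u).
  by symmetry; apply: vquot_pi_scale.
have : \pi_(cotangent m) u \in leigenspace (rho m xi) c.
  by rewrite leigenspaceP rho_u piZ cotangent_piE xi_u linearZ /= ux scalerN.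
rewrite /leigenvalue; apply: contraTneq => ->; rewrite memv0.
rewrite -(scale0r (\pi_(cotangent m) u)) piZ cotangent_piE.
by rewrite scale0r linear0 addr0 ux.
Qed.

Lemma Der_cotangent_eigenval (s : A) xi c :
    gorenstein m -> full_null_index m -> s \in soc m -> s != 0 ->
    xi \in Der A -> xi != 0 -> xi s = 0 -> leigenvalue (rho m xi) c ->
  c = 0.
Proof.
move=> gm nm sm s0 dxi xi0 xis rc.
have [v []] := nm r s hr sm s0 xi dxi xi0 c rc.
pose u := repr v; pose x := vsval u; rewrite leigenspaceP => /eqP eig_v _ Pv.
have def_v : v = \pi_(cotangent m) u by rewrite reprK.
have mx : x \in m by apply: subvsP.
have [rho_u xi_u] := rhoE u F0 lm hr dxi.
have m2x : xi x - c *: x \in (m ^+ 2)%VS.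
  have : \pi_(cotangent m) (vsproj m (xi x)) == \pi_(cotangent m) (c *: u).
    by rewrite -rho_u -def_v eig_v {1}def_v; apply/eqP/esym/vquot_pi_scale.
  by rewrite cotangent_piE xi_u linearZ /= scalerN.
have := index_polyE u (local_ideal lm) gm hr sm s0; rewrite -def_v -/x.
case: r hr Pv => [|n] [_ mn0] Pv xr.
  have /socP[ms _] := sm; move: mn0; rewrite expv1 => m0.
  by rewrite m0 memv0 (negPf s0) in ms.
have : xi (x ^+ n.+1) = 0 by rewrite xr linearZ /= xis scaler0.
rewrite (DerX _ _ dxi) -[xi x](subrK (c *: x)) mulrDr -scalerAr -exprSr xr.
(* With [r = n + 1] this product lies in [m ^ n m ^ 2 = m ^ (r + 1) = 0], so the eigenvector
   equation modulo [m ^ 2] suffices. *)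
have -> : x ^+ n * (xi x - c *: x) = 0.
  by apply/eqP; rewrite -memv0 -mn0 -addn2 expvD memv_mul ?memvXn.
rewrite add0r => /eqP; rewrite -scaler_nat !scaler_eq0 (negPf s0) (negPf Pv).
by rewrite ((pcharf0P F).1 F0) !orbF => /eqP.
Qed.

(** Derivations preserve the socle, which is a line; they act on it by scalars, and scalars
    commute. *)
Lemma Der_comm_soc s xi : gorenstein m -> s \in soc m ->
  xi \in lie_brv (Der A) (Der A) -> xi s = 0.
Proof.
move=> gm sm; have [-> | s0] := eqVneq s 0; first by rewrite linear0.
have Der_s f : f \in Der A -> exists c, f s = c *: s.
  move=> df; apply/vlineP; rewrite -(soc_line gm sm s0); apply/socP.
  have /socP[ms sm0] := sm; split=> [|x mx]; first exact: Der_max.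
  have := sm0 x mx => /(congr1 f); rewrite linear0; move/DerP: (df) ->.
  by rewrite (sm0 (f x)) ?Der_max // addr0.
pose ev : 'End(A) -> A := fun f => f s.
have ev_lin : linear ev by move=> a f g; rewrite /ev add_lfunE scale_lfunE.
pose gev : {linear 'End(A) -> A} :=
  HB.pack ev (GRing.isLinear.Build F 'End(A) A *:%R ev ev_lin).
suff /subvP sk : (lie_brv (Der A) (Der A) <= lker (linfun gev))%VS.
  by move/sk; rewrite memv_ker lfunE => /eqP.
apply/lie_brvP => f g /Der_s[a fs] /Der_s[b gs].
rewrite memv_ker lfunE /= /ev lie_brE gs fs !linearZ /= gs fs.
by rewrite scalerN !scalerA mulrC subrr.
Qed.

End Derivations.

Lemma Der_nilpotent (F : closedFieldType) (A : comFalgType F) (m : {vspace A})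
    (r : nat) (xi : 'End(A)) :
    [pchar F] =i pred0 -> local_with m -> nil_index m r -> xi \in Der A ->
    (forall c, leigenvalue (rho m xi) c -> c = 0) ->
  exists p, xi ^+ p = 0.
Proof.
move=> F0 lm hr dxi eig0.
have xim2 y : y \in (m ^+ 2)%VS -> xi y \in (m ^+ 2)%VS.
  by apply: (Der_expv F0 lm hr dxi).
have [s xis] := split_annihilator xi.
have nil2 : {in m, forall x, (xi ^+ size s) x \in (m ^+ 2)%VS}.
  (* Each factor [xi - c%:A] of the annihilating product is traded for [xi], using that for [c != 0]
     it is injective on [m / m ^ 2]. *)
  suff main t x : x \in m -> (\prod_(c <- t) (xi - c%:A)) x \in (m ^+ 2)%VS ->
      (xi ^+ size t) x \in (m ^+ 2)%VS.
    by move=> x mx; apply: main; rewrite // xis zero_lfunE mem0v.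
  elim: t x => [|c t IHt] x mx; first by rewrite big_nil expr0.
  have xi_m y k : y \in m -> (xi ^+ k) y \in m.
    by rewrite -[m]expv1; apply: (Der_iter_expv F0 lm hr _ dxi).
  rewrite big_cons lfun_mulE => /IHt.
  have xic y : (xi - c%:A) y = xi y - c *: y.
    by rewrite add_lfunE opp_lfunE scale_lfunE id_lfunE.
  rewrite xic memvB ?memvZ ?(xi_m x 1%N) // => /(_ isT).
  rewrite linearB linearZ /= -!lfun_mulE -exprS exprSr lfun_mulE.
  have [-> | c0] := eqVneq c 0; first by rewrite scale0r subr0.
  move=> m2y; apply: xim2; apply: contraT => m2z; case/eqP: c0.
  by apply: eig0; apply: (eigen_cotangent F0 lm hr dxi _ m2z); rewrite ?xi_m.
have [n niln] := Der_nilpotent_max F0 lm hr dxi nil2.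
(* The extra application of [xi] kills the scalar part of [x]. *)
exists n.+1; apply/lfunP=> x; have [c mx] := local_decomp lm x.
have -> : (xi ^+ n.+1) x = (xi ^+ n) (xi (x - c%:A)).
  by rewrite linearB linearZ /= (Der1 dxi) scaler0 subr0 exprS lfun_mulE.
by rewrite zero_lfunE niln // (Der_max_ideal F0 lm hr).
Qed.

Theorem theorem2 (R : realType) (A : comFalgType R[i]) (m : {vspace A}) :
  local_with m -> gorenstein m -> full_null_index m -> lie_solvable (Der A).
Proof.
move=> lm gm nm; have F0 : [pchar R[i]] =i pred0 := pchar_num _.
have [r hr] := nil_index_ex lm.
pose D := lie_brv (Der A) (Der A).
have sD : (D <= Der A)%VS by apply: Der_lie.
have DD : bracket_closed D.
  move=> f g /(subvP sD) Df /(subvP sD) Dg.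
  (* The ring product of ['End(A)] is composition in reverse order, so this commutator is
     [lie_br g f]. *)
  by have /lie_brvP := subvv D; apply.
have nilD : {in D, forall xi, exists p, xi ^+ p = 0}.
  (* Full null-index constrains nonzero derivations only. *)
  move=> xi Dxi; have [-> | xi0] := eqVneq xi 0.
    by exists 1%N; rewrite expr1.
  have dxi := subvP sD _ Dxi.
  have [s sm s0] : exists2 s, s \in soc m & s != 0.
    exists (vpick (soc m)); rewrite ?memv_pick // vpick0 -dimv_eq0.
    by rewrite gm.
  apply: (Der_nilpotent F0 lm hr dxi) => c.
  apply: (Der_cotangent_eigenval F0 lm hr gm nm sm s0 dxi xi0).
  exact: (Der_comm_soc F0 lm hr gm sm).
have [n Dn] := engel_expv DD nilD.
(* One step leads from [Der A] to [D]; [n] more reach [D ^+ (2 ^ n)], which vanishes because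
   [n <= 2 ^ n]. *)
exists n.+1; apply/eqP; rewrite -subv0 /derived_series iterSr.
apply: subv_trans (derived_series_expv D n) _.
by rewrite -(subnKC (ltnW (ltn_expl n (ltnSn 1)))) expvD Dn prod0v.
Qed.
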